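(* Let $\Sigma$ be a finite alphabet, let $G_X=(V_X,E_X,L_X)$ and $G_Y=(V_Y,E_Y,L_Y)$ be finite directed graphs with edge labelings $L_X:E_X\to\Sigma$, $L_Y:E_Y\to\Sigma$, neither having parallel edges with the same label, and let $X,Y\subseteq\Sigma^{\mathbb{Z}}$ be the constrained systems they present. Let $P_Y=(\pi_Y,Q_Y)$ be a stationary Markov chain on $G_Y$ whose induced hidden Markov measure $\mu$ on $Y$ is ergodic. Let $E_{X\times Y}=E_X\times E_Y$ and $V_{X\times Y}=V_X\times V_Y$, with $\sigma(e_x,e_y)=(\sigma(e_x),\sigma(e_y))$ and $\tau(e_x,e_y)=(\tau(e_x),\tau(e_y))$. Then $R_0(X,Y,\mu)\le\mathrm{MB}(G_X,G_Y,P_Y)$, where $\mathrm{MB}(G_X,G_Y,P_Y)$ is the optimal value of the linear program: minimize $\sum_{e=(e_x,e_y)\in E_{X\times Y},\ L_X(e_x)\ne L_Y(e_y)}P(e)$ over $P\in\mathbb{R}^{E_{X\times Y}}$ subject to (1) $P(e)\ge0$ for all $e\in E_{X\times Y}$; (2) $\sum_{e\in E_{X\times Y}}P(e)=1$; (3) $\sum_{e'\in E_{X\times Y},\ e'_y=e}P(e')=P_Y(e)$ for all $e\in E_Y$; (4) $\sum_{e\in E_{X\times Y},\ \sigma(e)=v}P(e)=\sum_{e\in E_{X\times Y},\ \tau(e)=v}P(e)$ for all $v\in V_{X\times Y}$; (5) for all $e=(e_x,e_y)\in E_{X\times Y}$: $\sum_{e'\in E_{X\times Y},\ e'_y=e_y,\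 \sigma(e'_x)=\sigma(e_x)}P(e')=Q_Y(e_y)\sum_{e'\in E_{X\times Y},\ \sigma(e'_y)=\sigma(e_y),\ \sigma(e'_x)=\sigma(e_x)}P(e')$.
   Context: For a labeled graph $G$, the constrained system it presents is the set of label sequences of bi-infinite directed paths in $G$. A stationary Markov chain on a finite directed graph $(W,F)$ is a probability measure $P$ on $F$ with $\pi(w):=\sum_{\sigma(e)=w}P(e)=\sum_{\tau(e)=w}P(e)$ and $\pi(w)>0$ for every vertex $w$; $Q(e)=P(e)/\pi(\sigma(e))$; we write $P=(\pi,Q)$. The hidden Markov measure induced on $Y$ by $P_Y$ is the shift-invariant measure with $\mu(\{\mathbf{y}:\mathbf{y}_0^{n-1}=\overline{y}\})=\sum P_Y(e_0)\prod_{i=1}^{n-1}Q_Y(e_i)$, the sum over paths $e_0\cdots e_{n-1}$ in $G_Y$ with label sequence $\overline{y}$. $\mathscr{B}_n(X)$ is the set of length-$n$ words appearing in elements of $X$; $d$ is Hamming distance, $B_r$ the Hamming ball. For $A,C\subseteq\Sigma^n$, a probability measure $\eta$ on $\Sigma^n$ and $\varepsilon>0$: $R_\varepsilon(C,A,\eta)=\min\{r\in\mathbb{Z}_{\ge0}:\eta(A\cap\bigcup_{\overline{x}\in C}B_r(\overline{x}))\ge1-\varepsilon\}$. With $\mu_n$ the marginal of $\mu$ on coordinates $0,\dots,n-1$: $R_\varepsilon(X,Y,\mu)=\liminf_n\frac1nR_\varepsilon(\mathscr{B}_n(X),\mathscr{B}_n(Y),\mu_n)$ and $R_0(X,Y,\mu)=\lim_{\varepsilon\to0}R_\varepsilon(X,Y,\mu)$.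 *)

(* Defs.v *)
From HB Require Import structures.
From mathcomp Require Import all_boot all_order all_algebra.
From mathcomp Require Import all_classical all_reals all_analysis.
Set Implicit Arguments. Unset Strict Implicit. Unset Printing Implicit Defensive.
Import Order.TTheory GRing.Theory Num.Theory.
Import numFieldNormedType.Exports.
Local Open Scope classical_set_scope.
Local Open Scope ring_scope.

Record lgraph (S : finType) := LGraph {
  gV : finType ;
  gE : finType ;
  gsrc : gE -> gV ;
  gtgt : gE -> gV ;
  glab : gE -> S }.

Definition no_parallel_same_label (S : finType) (G : lgraph S) : Prop :=
  forall e e' : gE G, gsrc e = gsrc e' -> gtgt e = gtgt e' ->
    glab e = glab e' -> e = e'.

(* bi-infinite sequences over S; the point a0 witnesses that S is nonempty *)
Definition shiftsp (S : finType) (a0 : S) : Type := int -> S.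
HB.instance Definition _ (S : finType) (a0 : S) :=
  Choice.on (shiftsp a0).
HB.instance Definition _ (S : finType) (a0 : S) :=
  isPointed.Build (shiftsp a0) (fun _ => a0).

Definition coordG (S : finType) (a0 : S) : set (set (shiftsp a0)) :=
  [set A | exists (k : int) (a : S), A = [set x | x k = a]].
Definition seqMeas (S : finType) (a0 : S) := g_sigma_algebraType (@coordG S a0).

Definition shift (S : finType) (a0 : S) (x : seqMeas a0) : seqMeas a0 :=
  fun i => x (i + 1)%R.

Definition csystem (S : finType) (a0 : S) (G : lgraph S) : set (seqMeas a0) :=
  [set x | exists p : int -> gE G,
     (forall i : int, gtgt (p i) = gsrc (p (i + 1)%R)) /\
     (forall i : int, x i = glab (p i))].

Definition word (S : finType) (n : nat) := {ffun 'I_n -> S}.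

Definition langB (S : finType) (a0 : S) (X : set (seqMeas a0)) (n : nat)
  (w : word S n) : Prop :=
  exists x, X x /\ exists k : int, forall i : 'I_n, w i = x (k + (i : nat)%:Z)%R.

Definition cyl0 (S : finType) (a0 : S) (n : nat) (w : word S n)
  : set (seqMeas a0) :=
  [set x | forall i : 'I_n, x (i : nat)%:Z = w i].

Definition hamming (S : finType) (n : nat) (x w : word S n) : nat :=
  #|[set i : 'I_n | x i != w i]|.

Section MC.
Variables (R : realType) (S : finType).

Definition mc_pi (G : lgraph S) (P : gE G -> R) (w : gV G) : R :=
  \sum_(e : gE G | gsrc e == w) P e.
Definition mc_Q (G : lgraph S) (P : gE G -> R) (e : gE G) : R :=
  P e / mc_pi P (gsrc e).

Definition stationary_mc (G : lgraph S) (P : gE G -> R) : Prop :=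
  [/\ (forall e, 0 <= P e),
      \sum_(e : gE G) P e = 1,
      (forall w : gV G, \sum_(e : gE G | gsrc e == w) P e
                        = \sum_(e : gE G | gtgt e == w) P e) &
      (forall w : gV G, 0 < mc_pi P w)].

Definition hmm_prob (G : lgraph S) (P : gE G -> R) (n : nat)
  (w : word S n.+1) : R :=
  \sum_(p : {ffun 'I_n.+1 -> gE G} |
          [forall i : 'I_n, gtgt (p (widen_ord (leqnSn n) i)) == gsrc (p (lift ord0 i))]
          && [forall i : 'I_n.+1, glab (p i) == w i])
     (P (p ord0) * \prod_(i : 'I_n) mc_Q P (p (lift ord0 i))).

Definition is_hmm_measure (a0 : S) (G : lgraph S) (P : gE G -> R)
  (mu : probability (seqMeas a0) R) : Prop :=
  (forall A : set (seqMeas a0), measurable A ->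
     mu (@shift S a0 @^-1` A) = mu A) /\
  (forall (n : nat) (w : word S n.+1), mu (@cyl0 S a0 _ w) = (hmm_prob P w)%:E).

Definition ergodic (a0 : S) (mu : probability (seqMeas a0) R) : Prop :=
  forall A : set (seqMeas a0), measurable A -> @shift S a0 @^-1` A = A ->
    mu A = 0%E \/ mu A = 1%E.

Definition mu_n (a0 : S) (mu : probability (seqMeas a0) R) (n : nat)
  (A : word S n -> Prop) : R :=
  \sum_(w : word S n | `[< A w >]) fine (mu (@cyl0 S a0 _ w)).

(* R_eps(B_n(X), B_n(Y), mu_n); +oo if no r works (min of empty set) *)
Definition Reps_n (a0 : S) (X Y : set (seqMeas a0))
  (mu : probability (seqMeas a0) R) (eps : R) (n : nat) : \bar R :=
  ereal_inf [set (r%:R)%:E | r in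
    [set r : nat | 1 - eps <= mu_n mu (fun w : word S n =>
        langB Y w /\ exists x : word S n, langB X x /\ (hamming x w <= r)%N)]].

Definition Reps (a0 : S) (X Y : set (seqMeas a0))
  (mu : probability (seqMeas a0) R) (eps : R) : \bar R :=
  limn_einf (fun n : nat => ((n%:R)^-1)%:E * Reps_n X Y mu eps n)%E.

Definition R0 (a0 : S) (X Y : set (seqMeas a0))
  (mu : probability (seqMeas a0) R) : \bar R :=
  lim (Reps X Y mu @ (0:R)^'+).

Definition MB_feasible (GX GY : lgraph S) (PY : gE GY -> R)
  (P : gE GX * gE GY -> R) : Prop :=
  [/\ (forall e, 0 <= P e),
      \sum_(e : gE GX * gE GY) P e = 1,
      (forall ey : gE GY, \sum_(e : gE GX * gE GY | e.2 == ey) P e = PY ey),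
      (forall v : gV GX * gV GY,
         \sum_(e : gE GX * gE GY | (gsrc e.1, gsrc e.2) == v) P e
       = \sum_(e : gE GX * gE GY | (gtgt e.1, gtgt e.2) == v) P e) &
      (forall e : gE GX * gE GY,
         \sum_(e' : gE GX * gE GY | (e'.2 == e.2) && (gsrc e'.1 == gsrc e.1)) P e'
       = mc_Q PY e.2 *
         \sum_(e' : gE GX * gE GY |
                 (gsrc e'.2 == gsrc e.2) && (gsrc e'.1 == gsrc e.1)) P e')].

Definition MB_objective (GX GY : lgraph S) (P : gE GX * gE GY -> R) : R :=
  \sum_(e : gE GX * gE GY | glab e.1 != glab e.2) P e.

(* optimal value of the LP (+oo if infeasible) *)
Definition MB (GX GY : lgraph S) (PY : gE GY -> R) : \bar R :=
  ereal_inf [set (@MB_objective GX GY P)%:E | P in @MB_feasible GX GY PY].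

End MC.

(* Main.v *)
Require Import Defs.
From HB Require Import structures.
From mathcomp Require Import all_boot all_order all_algebra.
From mathcomp Require Import all_classical all_reals all_analysis.
From mathcomp Require Import measurable_realfun ring lra.
Set Implicit Arguments. Unset Strict Implicit. Unset Printing Implicit Defensive.
Import Order.TTheory GRing.Theory Num.Theory.
Import numFieldNormedType.Exports.
Local Open Scope classical_set_scope.
Local Open Scope ring_scope.

(** Let f n y be the Hamming distance from the word y_0 ... y_(n-1) to the
    language of X. The hidden Markov path measure of an LP-feasible P on the
    product graph is, by condition (5), a coupling of a process on X with the
    Markov chain on G_Y, so the mean of f n is at most n times the objective
    value; P itself need not be ergodic. On the other hand
      m * f n y >= sum_(i <= n - m) f m (T^i y),
    so by the ergodic theorem for mu (only the lower bound in probability is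
    needed, and it follows from the maximal ergodic inequality) f n / n is with
    high probability at least almost c = sup_m mean (f m) / m. Since its mean is
    at most c, f n / n concentrates at c, which is at most the objective value. *)

(** * Maximal ergodic inequality *)

Section bounded_measurable.
Context d (T : measurableType d) (R : realType) (mu : probability T R).
Implicit Types f g : T -> R.

Definition bmeas f := measurable_fun setT f /\ exists M : R, forall x, `|f x| <= M.

Definition mean f := \int[mu]_(x in setT) f x.

Lemma bmeas_integrable f : bmeas f -> mu.-integrable setT (EFin \o f).
Proof.
move=> [mf [M fM]]; apply: measurable_bounded_integrable => //.
  by rewrite (le_lt_trans (probability_le1 _ _)) ?ltry.
exists M; split; first by rewrite num_real.
by move=> N MN x _ /=; rewrite (le_trans (fM x))// ltW.
Qed.

Lemma bmeas_cst c : bmeas (fun=> c).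
Proof. by split=> //; exists `|c|. Qed.

Lemma bmeasD f g : bmeas f -> bmeas g -> bmeas (fun x => f x + g x).
Proof.
move=> [mf [M fM]] [mg [N gN]]; split; first exact: measurable_funD.
by exists (M + N) => x; rewrite (le_trans (ler_normD _ _))// lerD.
Qed.

Lemma bmeasZ c f : bmeas f -> bmeas (fun x => c * f x).
Proof.
move=> [mf [M fM]]; split; first exact: measurable_funM.
by exists (`|c| * M) => x; rewrite normrM ler_wpM2l.
Qed.

Lemma bmeasN f : bmeas f -> bmeas (fun x => - f x).
Proof.
move=> [mf [M fM]]; split; first exact: measurableT_comp.
by exists M => x; rewrite normrN.
Qed.

Lemma bmeas_max f g : bmeas f -> bmeas g -> bmeas (fun x => Num.max (f x) (g x)).
Proof.
move=> [mf [M fM]] [mg [N gN]]; split; first exact: measurable_maxr.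
exists (Num.max M N) => x; rewrite le_max.
by case: (leP (f x) (g x)) => _; rewrite ?fM ?gN ?orbT.
Qed.

Lemma bmeas_indic (A : set T) : measurable A -> bmeas (\1_A : T -> R).
Proof.
move=> mA; split; first exact: measurable_indic.
by exists 1 => x; rewrite indicE; case: (_ \in _); rewrite ?normr0 ?normr1.
Qed.

Lemma bmeas_sum (I : Type) (r : seq I) (P : pred I) (F : I -> T -> R) :
  (forall i, bmeas (F i)) -> bmeas (fun x => \sum_(i <- r | P i) F i x).
Proof.
move=> bF; elim: r => [|i r IH].
  by under eq_fun do rewrite big_nil; exact: bmeas_cst.
under eq_fun do rewrite big_cons.
by case: (P i) => //; exact: bmeasD.
Qed.

Lemma bmeas_measurable_lt f c : bmeas f -> measurable [set x | f x < c].
Proof.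
move=> [mf _]; rewrite (_ : [set _ | _] = f @^-1` `]-oo, c[%classic).
  by rewrite -[X in measurable X]setTI; exact: mf.
by apply/seteqP; split => x /=; rewrite in_itv.
Qed.

Lemma bmeas_measurable_le f c : bmeas f -> measurable [set x | f x <= c].
Proof.
move=> [mf _]; rewrite (_ : [set _ | _] = f @^-1` `]-oo, c]%classic).
  by rewrite -[X in measurable X]setTI; exact: mf.
by apply/seteqP; split => x /=; rewrite in_itv.
Qed.

Lemma mean_cst c : mean (fun=> c) = c.
Proof.
rewrite /mean Rintegral_cst// -[RHS]mulr1 -[X in _ = _ * X]/(fine 1%E).
by congr (_ * fine _); exact: probability_setT.
Qed.

Lemma meanD f g : bmeas f -> bmeas g ->
  mean (fun x => f x + g x) = mean f + mean g.
Proof. by move=> bf bg; rewrite /mean RintegralD//; exact: bmeas_integrable. Qed.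

Lemma meanZ c f : bmeas f -> mean (fun x => c * f x) = c * mean f.
Proof. by move=> bf; rewrite /mean RintegralZl//; exact: bmeas_integrable. Qed.

Lemma mean_le f g : bmeas f -> bmeas g -> (forall x, f x <= g x) ->
  mean f <= mean g.
Proof. by move=> bf bg fg; apply: le_Rintegral => //; exact: bmeas_integrable. Qed.

Lemma mean_indic (A : set T) : measurable A -> mean (\1_A : T -> R) = fine (mu A).
Proof. by move=> mA; rewrite /mean /Rintegral integral_indic// setIT. Qed.

Lemma mean_sum (I : Type) (r : seq I) (P : pred I) (F : I -> T -> R) :
  (forall i, bmeas (F i)) ->
  mean (fun x => \sum_(i <- r | P i) F i x) = \sum_(i <- r | P i) mean (F i).
Proof.
move=> bF; elim: r => [|i r IH].
  by under eq_fun do rewrite big_nil; rewrite big_nil mean_cst.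
under eq_fun do rewrite big_cons.
rewrite big_cons; case: (P i) => //.
by rewrite meanD ?IH//; exact: bmeas_sum.
Qed.

Section ergodic.
Variable phi : T -> T.
Hypothesis mphi : measurable_fun setT phi.
Hypothesis invphi : forall A, measurable A -> mu (phi @^-1` A) = mu A.
Hypothesis ergphi : forall A, measurable A -> phi @^-1` A = A ->
  mu A = 0%E \/ mu A = 1%E.

Lemma bmeas_comp f : bmeas f -> bmeas (f \o phi).
Proof.
move=> [mf [M fM]]; split; first exact: measurableT_comp.
by exists M => x /=.
Qed.

Lemma mean_comp f : bmeas f -> mean (f \o phi) = mean f.
Proof.
move=> bf; rewrite /mean /Rintegral; congr fine.
rewrite -[LHS](@integral_pushforward _ _ _ _ _ _ mphi mu setT (EFin \o f))//.
- apply: eq_measure_integral => A mA _; exact: invphi.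
- by apply/measurable_EFinP; case: bf.
- by apply: bmeas_integrable; exact: bmeas_comp.
Qed.

Definition bsum g n x := \sum_(i < n) g (iter i phi x).

Lemma bsumS g n x : bsum g n.+1 x = g x + bsum g n (phi x).
Proof.
rewrite /bsum big_ord_recl; congr (_ + _); apply: eq_bigr => i _.
by rewrite lift0 iterSr.
Qed.

Lemma bmeas_bsum g n : bmeas g -> bmeas (bsum g n).
Proof.
move=> bg; elim: n => [|n IH].
  rewrite (_ : bsum g 0 = fun=> 0); first exact: bmeas_cst.
  by apply/funext => x; rewrite /bsum big_ord0.
rewrite (_ : bsum g n.+1 = fun x => g x + (bsum g n \o phi) x).
  by apply: bmeasD => //; exact: bmeas_comp.
by apply/funext => x; rewrite bsumS.
Qed.

(** The recursion peels off the first term of the orbit instead of maximising over indices, so that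
    [bmax g n.+1] is written through [bmax g n \o phi]. *)
Fixpoint bmax g n : T -> R :=
  if n is n'.+1 then fun x => g x + Num.max 0 (bmax g n' (phi x)) else g.

Lemma bmeas_bmax g n : bmeas g -> bmeas (bmax g n).
Proof.
move=> bg; elim: n => //= n IH; apply: bmeasD => //.
apply: (@bmeas_max (fun=> 0) (bmax g n \o phi)); first exact: bmeas_cst.
exact: bmeas_comp.
Qed.

Lemma bmaxS g n x : bmax g n x <= bmax g n.+1 x.
Proof.
elim: n x => [|n IH] x /=; first by rewrite lerDl le_max lexx.
by rewrite lerD2l ge_max !le_max lexx /= -/(bmax g n.+1 _) IH orbT.
Qed.

Lemma bsum_le_bmax g n x : bsum g n.+1 x <= bmax g n x.
Proof.
elim: n x => [|n IH] x.
  by rewrite /bsum big_ord1.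
by rewrite bsumS /= lerD2l le_max IH orbT.
Qed.

Lemma bmax_ge g n x : g x <= bmax g n x.
Proof. by case: n => [|n] //=; rewrite lerDl le_max lexx. Qed.

(* [bmax g n] is the maximum of the first n.+1 nonempty partial sums; being
   monotone in n it satisfies mean (bmax g n) <= mean g + mean (max 0 (bmax g n)). *)
Lemma mean_bmax_neg g M n : bmeas g -> (forall x, `|g x| <= M) ->
  - mean g <= M * fine (mu [set x | bmax g n x < 0]).
Proof.
move=> bg gM.
have bF := bmeas_bmax n bg.
have mA := bmeas_measurable_lt 0 bF.
have bI : bmeas (fun x => M * \1_[set x | bmax g n x < 0] x).
  by apply: bmeasZ; exact: bmeas_indic.
have bP : bmeas (fun x => Num.max 0 (bmax g n x)).
  by apply: bmeas_max => //; exact: bmeas_cst.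
have h1 : mean (bmax g n) <= mean g + mean (fun x => Num.max 0 (bmax g n x)).
  rewrite -[X in _ + X]mean_comp// -meanD//; last exact: bmeas_comp.
  apply: mean_le => //; last by move=> x; exact: bmaxS.
  exact: (bmeas_bmax n.+1).
(* Where [bmax g n] is negative, replacing it by 0 raises it by at most [M], since
   [bmax g n x >= g x >= - M]; elsewhere nothing changes. *)
have h2 : mean (fun x => Num.max 0 (bmax g n x)) <=
    mean (bmax g n) + M * fine (mu [set x | bmax g n x < 0]).
  rewrite -mean_indic// -meanZ; last exact: bmeas_indic.
  rewrite -meanD//; apply: mean_le => //; first exact: bmeasD.
  move=> x; have := bmax_ge g n x; have /ler_normlP[] := gM x.
  rewrite indicE; have [h|h] := ltP (bmax g n x) 0.
    by rewrite mem_set// mulr1; lra.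
  by rewrite memNset ?mulr0 ?addr0//= => /lt_geF; rewrite h.
lra.
Qed.

(** The set is [phi]-invariant, so by ergodicity it has measure 0 or 1. It contains every point at
    which all [bmax g n] are negative; were it null, the decreasing events [bmax g n < 0] would have
    measure tending to 0, against the bound [- mean g / M > 0] from [mean_bmax_neg]. *)
Lemma bsum_ubounded g : bmeas g -> mean g < 0 ->
  mu [set x | exists K : nat, forall n, bsum g n x <= K%:R] = 1%E.
Proof.
move=> bg g0; set B := [set x | _].
have [_ [M gM]] := bg.
have M0 : 0 < M.
  rewrite ltNge; apply/negP => M0; move: g0; apply/negP; rewrite -leNgt.
  rewrite -(mean_cst 0); apply: mean_le => //; first exact: bmeas_cst.
  by move=> x; have := gM x; rewrite ler_norml => /andP[]; lra.
have mB : measurable B.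
  rewrite (_ : B = \bigcup_K \bigcap_n [set x | bsum g n x <= K%:R]).
    apply: bigcup_measurable => K _; apply: bigcap_measurable => // n _.
    by apply: bmeas_measurable_le; exact: bmeas_bsum.
  apply/seteqP; split => x [K]; first by move=> h; exists K => // n _ /=.
  by move=> _ h; exists K => n; apply: h.
(* Moving the start of the orbit by one step changes a Birkhoff sum by one value of [g], hence by at
   most [M]. *)
have iB : phi @^-1` B = B.
  apply/seteqP; split => x [K hK].
  - exists (K + Num.bound M)%N => -[|n]; first by rewrite /bsum big_ord0.
    rewrite bsumS natrD; have := hK n; have := archi_boundP (ltW M0).
    have := gM x; rewrite ler_norml => /andP[_]; lra.
  - exists (K + Num.bound M)%N => n.
    have := hK n.+1; rewrite bsumS natrD; have := archi_boundP (ltW M0).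
    have := gM x; rewrite ler_norml => /andP[]; lra.
have [B0|//] := ergphi mB iB.
pose F n := [set x | bmax g n x < 0].
have mF n : measurable (F n) by apply: bmeas_measurable_lt; exact: bmeas_bmax.
have mFI : measurable (\bigcap_n F n) by apply: bigcap_measurable.
have FB : \bigcap_n F n `<=` B.
  move=> x h; exists 0%N => -[|n]; first by rewrite /bsum big_ord0.
  by rewrite (le_trans (bsum_le_bmax g n x))// ltW//; exact: h.
have F0 : mu (\bigcap_n F n) = 0%E.
  by apply/eqP; rewrite -measure_le0 -B0; apply: le_measure; rewrite ?inE.
have : mu \o F @ \oo --> mu (\bigcap_n F n).
  apply: nonincreasing_cvg_mu => //.
    by rewrite (le_lt_trans (probability_le1 _ _)) ?ltry.
  apply/nonincreasing_seqP => n; apply/subsetPset => x /=.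
  exact: le_lt_trans (bmaxS g n x).
rewrite F0 => /fine_cvg/= cF.
have : (0 : R) >= - mean g / M.
  have := cvg_lim (@Rhausdorff R) cF; move=> <-.
  apply: limr_ge; first by apply/cvg_ex; exists 0.
  apply: nearW => n; rewrite ler_pdivrMr// mulrC.
  exact: mean_bmax_neg.
by rewrite pmulr_lle0 ?invr_gt0// oppr_le0 leNgt g0.
Qed.

(* The lower half of Birkhoff's ergodic theorem, in probability and with a
   bounded error. *)
Lemma bsum_lower_bound f (eta eps : R) : bmeas f -> 0 < eta -> 0 < eps ->
  exists (K : nat) (B : set T), [/\ measurable B, (mu B < eps%:E)%E &
    forall x n, ~ B x -> n%:R * (mean f - eta) - K%:R <= bsum f n x].
Proof.
move=> bf eta0 eps0.
(* The mean of [g] is [- eta], so the Birkhoff sums of [g], which measure the deficit of those of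
   [f], are almost surely bounded above. *)
pose g x := (mean f - eta) + (- f x).
have bg : bmeas g by apply: bmeasD; [exact: bmeas_cst|exact: bmeasN].
have g0 : mean g < 0.
  rewrite meanD ?mean_cst//; [|exact: bmeas_cst|exact: bmeasN].
  rewrite (_ : (fun x => - f x) = fun x => -1 * f x); last first.
    by apply/funext => x; rewrite mulN1r.
  by rewrite meanZ//; lra.
have gE n x : bsum g n x = n%:R * (mean f - eta) - bsum f n x.
  by rewrite /bsum /g big_split/= sumr_const card_ord sumrN mulr_natl.
have h1 := bsum_ubounded bg g0.
(* The sets where the deficit exceeds [K] decrease to a null set, so one of them is smaller than
   [eps] and serves as [B]. *)
pose F (K : nat) := [set x | exists n, K%:R < bsum g n x].
have mF K : measurable (F K).
  rewrite (_ : F K = \bigcup_n ~` [set x | bsum g n x <= K%:R]).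
    apply: bigcup_measurable => n _; apply: measurableC.
    by apply: bmeas_measurable_le; exact: bmeas_bsum.
  apply/seteqP; split => x [n]; first by move=> h; exists n => //=; apply/negP; rewrite -ltNge.
  by move=> _ /= /negP; rewrite -ltNge; exists n.
have : mu \o F @ \oo --> mu (\bigcap_n F n).
  apply: nonincreasing_cvg_mu => //; last 2 first.
  - exact: bigcap_measurable.
  - apply/nonincreasing_seqP => n; apply/subsetPset => x [k hk]; exists k.
    by rewrite (le_lt_trans _ hk)// ler_nat.
  by rewrite (le_lt_trans (probability_le1 _ _)) ?ltry.
have -> : \bigcap_n F n = ~` [set x | exists K : nat, forall n, bsum g n x <= K%:R].
  apply/seteqP; split => x.
    by move=> h [K hK]; have [n] := h K I; rewrite ltNge hK.
  move=> h K _; apply: contrapT => h2; apply: h; exists K => n.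
  by rewrite leNgt; apply/negP => h3; apply: h2; exists n.
rewrite probability_setC; last first.
  rewrite (_ : [set x | _] = ~` (\bigcap_n F n)).
    by apply: measurableC; exact: bigcap_measurable.
  apply/seteqP; split => x.
    by move=> [K hK] h; have [n] := h K I; rewrite ltNge hK.
  move=> h; apply: contrapT => h2; apply: h => K _.
  apply: contrapT => h3; apply: h2; exists K => n.
  by rewrite leNgt; apply/negP => h4; apply: h3; exists n.
rewrite h1 subee// => cF.
have : \forall K \near \oo, (mu (F K) < eps%:E)%E.
  apply: (cF [set y | (y < eps%:E)%E]); apply: open_nbhs_nbhs; split.
    exact: open_ereal_lt_ereal.
  by rewrite /= lte_fin.
move=> [K _ /(_ K (leqnn K)) hK]; exists K, (F K); split=> // x n nF.
rewrite leNgt; apply/negP => h; apply: nF; exists n; move: h; rewrite gE; lra.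
Qed.
End ergodic.

End bounded_measurable.

(** * Path weights of a flow *)

Section ffun_rcons.
Variable E : finType.

(** [insub (val i)] is [None] exactly at the last index, where the default [e] is returned. *)
Definition frcons n (p : {ffun 'I_n -> E}) (e : E) : {ffun 'I_n.+1 -> E} :=
  [ffun i => oapp p e (insub (val i))].

Lemma frconsl n (p : {ffun 'I_n -> E}) e (i : 'I_n.+1) (j : 'I_n) :
  i = j :> nat -> frcons p e i = p j.
Proof. by move=> ij; rewrite ffunE /= ij valK. Qed.

Lemma frconsr n (p : {ffun 'I_n -> E}) e (i : 'I_n.+1) :
  i = n :> nat -> frcons p e i = e.
Proof. by move=> ij; rewrite ffunE /= ij insubF ?ltnn. Qed.

Lemma sum_frcons (V : nmodType) n (F : {ffun 'I_n.+1 -> E} -> V) :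
  \sum_q F q = \sum_p \sum_e F (frcons p e).
Proof.
rewrite pair_bigA /=.
pose unr (q : {ffun 'I_n.+1 -> E}) :=
  ([ffun i : 'I_n => q (widen_ord (leqnSn n) i)], q ord_max).
rewrite (reindex (fun pe : {ffun 'I_n -> E} * E => frcons pe.1 pe.2))//.
exists unr => [[p e] _|q _]; rewrite /unr /=.
  congr pair; last by rewrite frconsr.
  by apply/ffunP => i; rewrite ffunE (frconsl _ _ (j := i)).
apply/ffunP => i; case: (ltnP i n) => [lin|nin].
  rewrite (frconsl _ _ (j := Ordinal lin))// ffunE.
  by congr (q _); exact: val_inj.
have ein : i = n :> nat by apply/eqP; rewrite eqn_leq nin -ltnS ltn_ord.
by rewrite frconsr//; congr (q _); exact: val_inj.
Qed.

Lemma sum_ffun1 (V : nmodType) (F : {ffun 'I_1 -> E} -> V) :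
  \sum_q F q = \sum_e F [ffun=> e].
Proof.
rewrite (reindex (fun e : E => [ffun=> e]))//.
exists (fun q : {ffun 'I_1 -> E} => q ord0) => [e _|q _]; first by rewrite ffunE.
by apply/ffunP => i; rewrite ffunE [i]ord1.
Qed.

End ffun_rcons.

Section flow.
Variables (R : realType) (S : finType) (G : lgraph S) (P : gE G -> R).

Definition is_path n (p : {ffun 'I_n.+1 -> gE G}) : bool :=
  [forall i : 'I_n, gtgt (p (widen_ord (leqnSn n) i)) == gsrc (p (lift ord0 i))].

(** Edge sequences that are not paths get weight 0, so sums run over all finite functions and can be
    split at the last edge. *)
Definition pathw n (p : {ffun 'I_n.+1 -> gE G}) : R :=
  (is_path p)%:R * (P (p ord0) * \prod_(i < n) mc_Q P (p (lift ord0 i))).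

Definition labels n (p : {ffun 'I_n -> gE G}) : word S n := [ffun i => glab (p i)].

Lemma hmm_probE n (w : word S n.+1) :
  hmm_prob P w = \sum_(p : {ffun 'I_n.+1 -> gE G} | labels p == w) pathw p.
Proof.
rewrite /hmm_prob [LHS]big_mkcond [RHS]big_mkcond; apply: eq_bigr => p _.
rewrite /pathw -/(is_path p).
have -> : [forall i : 'I_n.+1, glab (p i) == w i] = (labels p == w).
  apply/forallP/eqP => [h|<- i]; last by rewrite ffunE.
  by apply/ffunP => i; rewrite ffunE; exact/eqP.
by case: (is_path p); case: (_ == _); rewrite ?mul1r ?mul0r.
Qed.

Lemma is_path_frcons n (p : {ffun 'I_n.+1 -> gE G}) e :
  is_path (frcons p e) = is_path p && (gtgt (p ord_max) == gsrc e).
Proof.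
have fst (i : 'I_n.+1) (j : 'I_n) : i = j :> nat -> (gtgt (frcons p e (widen_ord (leqnSn n.+1) i))
    == gsrc (frcons p e (lift ord0 i)))
    = (gtgt (p (widen_ord (leqnSn n) j)) == gsrc (p (lift ord0 j))).
  move=> ij; rewrite (frconsl _ _ (j := widen_ord (leqnSn n) j))//.
  by rewrite (frconsl _ _ (j := lift ord0 j))// !lift0 ij.
have lst (i : 'I_n.+1) : i = n :> nat -> (gtgt (frcons p e (widen_ord (leqnSn n.+1) i))
    == gsrc (frcons p e (lift ord0 i))) = (gtgt (p ord_max) == gsrc e).
  by move=> ij; rewrite (frconsl _ _ (j := ord_max))// frconsr// lift0 ij.
apply/forallP/andP => [h|[/forallP h1 h2] i].
  split; last by have := h ord_max; rewrite lst.
  by apply/forallP => i; have := h (widen_ord (leqnSn n) i); rewrite (fst _ i).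
have [lin|nin] := ltnP i n; first by rewrite (fst _ (Ordinal lin)).
by rewrite lst//; apply/eqP; rewrite eqn_leq nin -ltnS ltn_ord.
Qed.

Lemma pathw_frcons n (p : {ffun 'I_n.+1 -> gE G}) e :
  pathw (frcons p e) =
  pathw p * ((gtgt (p ord_max) == gsrc e)%:R * mc_Q P e).
Proof.
rewrite /pathw is_path_frcons big_ord_recr /=.
rewrite (frconsl _ _ (j := ord0))// [frcons p e (lift ord0 ord_max)]frconsr//.
under eq_bigr => i _ do rewrite (frconsl _ _ (j := lift ord0 i))//.
by rewrite -mulnb natrM; ring.
Qed.

Hypothesis P_ge0 : forall e, 0 <= P e.
Hypothesis P_bal : forall w : gV G,
  \sum_(e : gE G | gsrc e == w) P e = \sum_(e : gE G | gtgt e == w) P e.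

Lemma mc_pi_ge0 v : 0 <= mc_pi P v.
Proof. by apply: sumr_ge0 => e _. Qed.

Lemma mc_pi_src_gt0 e : P e != 0 -> 0 < mc_pi P (gsrc e).
Proof.
move=> e0; rewrite /mc_pi (bigD1 e)//= ltr_pwDl ?lt0r ?e0 ?P_ge0//.
by apply: sumr_ge0.
Qed.

Lemma mc_pi_tgt_gt0 e : P e != 0 -> 0 < mc_pi P (gtgt e).
Proof.
move=> e0; rewrite /mc_pi P_bal (bigD1 e)//= ltr_pwDl ?lt0r ?e0 ?P_ge0//.
by apply: sumr_ge0.
Qed.

Lemma mc_Q_ge0 e : 0 <= mc_Q P e.
Proof. by rewrite /mc_Q divr_ge0 ?mc_pi_ge0. Qed.

Lemma mc_Q_neq0 e : mc_Q P e != 0 -> P e != 0.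
Proof. by apply: contra_neq => e0; rewrite /mc_Q e0 mul0r. Qed.

(** Positivity of [mc_pi P v] is not assumed, because a feasible point of the program may leave
    vertices without mass; if [P e = 0], both sides vanish. *)
Lemma mul_mc_Q v e : gsrc e = v -> mc_pi P v * mc_Q P e = P e.
Proof.
move=> <-; rewrite /mc_Q; have [e0|e0] := eqVneq (P e) 0.
  by rewrite e0 mul0r mulr0.
by rewrite mulrC divfK// gt_eqF// mc_pi_src_gt0.
Qed.

Lemma mc_Q_sum1 v : 0 < mc_pi P v -> \sum_(e | gsrc e == v) mc_Q P e = 1.
Proof.
move=> v0; apply: (mulfI (lt0r_neq0 v0)); rewrite mulr1 mulr_sumr.
by apply: eq_bigr => e /eqP h; rewrite mul_mc_Q.
Qed.

Lemma pathw_ge0 n (p : {ffun 'I_n.+1 -> gE G}) : 0 <= pathw p.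
Proof.
rewrite /pathw mulr_ge0 ?mulr_ge0//.
by apply: prodr_ge0 => i _; exact: mc_Q_ge0.
Qed.

Lemma pathw_path n (p : {ffun 'I_n.+1 -> gE G}) : pathw p != 0 -> is_path p.
Proof. by rewrite /pathw; case: (is_path p); rewrite // mul0r eqxx. Qed.

Lemma pathw_edge n (p : {ffun 'I_n.+1 -> gE G}) i : pathw p != 0 -> P (p i) != 0.
Proof.
rewrite /pathw !mulf_eq0 !negb_or => /and3P[_ p0 /prodf_neq0 h].
by case: (unliftP ord0 i) => [j|] -> //; apply: mc_Q_neq0; exact: h.
Qed.

(** One more step loses no mass: by balance the end vertex of a path of positive weight has positive
    mass, so [mc_Q P] is a probability on its outgoing edges. *)
Lemma pathw_step n (p : {ffun 'I_n.+1 -> gE G}) :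
  pathw p * (\sum_e (gtgt (p ord_max) == gsrc e)%:R * mc_Q P e) = pathw p.
Proof.
have [->|p0] := eqVneq (pathw p) 0; first by rewrite mul0r.
rewrite -[RHS]mulr1; congr (_ * _).
rewrite -[RHS](mc_Q_sum1 (mc_pi_tgt_gt0 (pathw_edge ord_max p0))) [RHS]big_mkcond.
by apply: eq_bigr => e _; rewrite eq_sym; case: eqP => _; rewrite ?mul1r ?mul0r.
Qed.

(** Stationarity: at every length the last edge is distributed as [P], since balance turns the mass
    entering a vertex into [mc_pi P]. *)
Lemma pathw_last n (h : gE G -> R) :
  \sum_(p : {ffun 'I_n.+1 -> gE G}) pathw p * h (p ord_max) = \sum_e P e * h e.
Proof.
elim: n h => [|n IH] h.
  rewrite sum_ffun1; apply: eq_bigr => e _.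
  have pe : is_path (n := 0) [ffun=> e] by apply/forallP => -[].
  by rewrite /pathw pe big_ord0 !ffunE mulr1 mul1r.
rewrite sum_frcons.
transitivity (\sum_(p : {ffun 'I_n.+1 -> gE G}) pathw p *
    \sum_e (gtgt (p ord_max) == gsrc e)%:R * mc_Q P e * h e).
  apply: eq_bigr => p _; rewrite mulr_sumr; apply: eq_bigr => e _.
  by rewrite pathw_frcons frconsr// -mulrA.
rewrite (IH (fun e' => \sum_e (gtgt e' == gsrc e)%:R * mc_Q P e * h e)).
under eq_bigr => e' _ do rewrite mulr_sumr.
rewrite exchange_big /=; apply: eq_bigr => e _.
rewrite -(mul_mc_Q (erefl (gsrc e))) /mc_pi P_bal !mulr_suml [RHS]big_mkcond /=.
by apply: eq_bigr => e' _; case: eqP => _; rewrite ?mul1r ?mul0r ?mulr0 ?mulrA.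
Qed.

(** By induction on the length: appending an edge leaves the earlier costs alone ([pathw_step]) and
    adds the mean cost of one edge ([pathw_last]). *)
Lemma pathw_cost n (c : gE G -> R) :
  \sum_(p : {ffun 'I_n.+1 -> gE G}) pathw p * (\sum_i c (p i)) =
  n.+1%:R * \sum_e P e * c e.
Proof.
elim: n => [|n IH].
  rewrite mul1r -(pathw_last 0); apply: eq_bigr => p _.
  by rewrite big_ord1; congr (_ * c (p _)); exact: val_inj.
rewrite -natr1 mulrDl mul1r -{1}IH -(pathw_last n.+1) [LHS]sum_frcons [X in _ + X]sum_frcons.
rewrite -big_split /=; apply: eq_bigr => p _.
have st : \sum_e pathw (frcons p e) = pathw p.
  by rewrite -[RHS]pathw_step mulr_sumr; apply: eq_bigr => e _; rewrite pathw_frcons.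
rewrite -[in RHS]st mulr_suml -big_split /=; apply: eq_bigr => e _.
rewrite -mulrDr big_ord_recr /=; congr (_ * (_ + _)).
by apply: eq_bigr => i _; rewrite (frconsl _ _ (j := i)).
Qed.

Lemma sum_pathw n : \sum_(p : {ffun 'I_n.+1 -> gE G}) pathw p = \sum_e P e.
Proof.
have := pathw_last n (fun=> 1); under eq_bigr do rewrite mulr1.
by under [X in _ = X -> _]eq_bigr do rewrite mulr1.
Qed.

Lemma flow_next e : P e != 0 -> exists e', P e' != 0 /\ gtgt e = gsrc e'.
Proof.
move=> /mc_pi_tgt_gt0/lt0r_neq0 h; apply: contrapT => nh.
move/eqP: h; apply; apply: big1 => e' /eqP es.
by apply/eqP; apply: contrapT => /negP e'0; apply: nh; exists e'.
Qed.

Lemma flow_prev e : P e != 0 -> exists e', P e' != 0 /\ gtgt e' = gsrc e.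
Proof.
move=> /mc_pi_src_gt0/lt0r_neq0 h; apply: contrapT => nh.
move/eqP: h; apply; rewrite /mc_pi P_bal; apply: big1 => e' /eqP es.
by apply/eqP; apply: contrapT => /negP e'0; apply: nh; exists e'.
Qed.

(* The flow leaves no dead end, so a path of positive weight extends in both
   directions. *)
Lemma biinfinite_extension n (p : {ffun 'I_n.+1 -> gE G}) : pathw p != 0 ->
  exists z : int -> gE G, (forall i : int, gtgt (z i) = gsrc (z (i + 1))) /\
    (forall i : 'I_n.+1, z i%:Z = p i).
Proof.
move=> p0.
have /choice[nx hnx] e : exists e', P e != 0 -> P e' != 0 /\ gtgt e = gsrc e'.
  by have [/flow_next[e' h]|h] := pselect (P e != 0); [exists e'|exists e].
have /choice[pv hpv] e : exists e', P e != 0 -> P e' != 0 /\ gtgt e' = gsrc e.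
  by have [/flow_prev[e' h]|h] := pselect (P e != 0); [exists e'|exists e].
have Pn k : P (iter k nx (p ord_max)) != 0.
  by elim: k => [|k IH] /=; [exact: pathw_edge|exact: (hnx _ IH).1].
have Pp k : P (iter k pv (p ord0)) != 0.
  by elim: k => [|k IH] /=; [exact: pathw_edge|exact: (hpv _ IH).1].
(* [p] occupies the positions 0 to [n]. Since [Negz k] is the integer -(k+1), it takes [k.+1]
   backward steps from the first edge. *)
pose z (i : int) := match i with
  | Posz k => if (k <= n)%N then p (inord k) else iter (k - n) nx (p ord_max)
  | Negz k => iter k.+1 pv (p ord0) end.
have z0 : z 0 = p ord0 by rewrite /z /=; congr (p _); apply: val_inj; rewrite /= inordK.
exists z; split; last first.
  by move=> i; rewrite /z -ltnS ltn_ord inord_val.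
case=> [k|[|k]]; last 2 first.
- rewrite (_ : Negz 0 + 1 = 0)// z0 /=; exact: (hpv _ (Pp 0%N)).2.
- rewrite (_ : Negz k.+1 + 1 = Negz k); last by rewrite !NegzE -[k.+2]addn1 PoszD; ring.
  exact: (hpv _ (Pp k.+1)).2.
rewrite -PoszD addn1 /z; have [kn|nk] := ltnP k n.
  rewrite (ltnW kn).
  have /forallP/(_ (Ordinal kn))/eqP := pathw_path p0.
  rewrite (_ : widen_ord _ _ = inord k).
    rewrite (_ : lift ord0 _ = inord k.+1)//.
    by apply: val_inj; rewrite /= inordK.
  by apply: val_inj; rewrite /= inordK// ltnS ltnW.
rewrite subSn// /= -(hnx _ (Pn (k - n)%N)).2.
move: nk; rewrite leq_eqVlt => /predU1P[<-|nk]; last by rewrite leqNgt nk.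
by rewrite leqnn subnn /=; congr (gtgt (p _)); apply: val_inj; rewrite /= inordK.
Qed.

End flow.

(** * The coupling given by a feasible point *)

Section coupling.
Variables (R : realType) (S : finType) (GX GY : lgraph S).

(** Edges carry the label of their [GX] coordinate, so the label word of a product path is the
    approximating word from the language of X. *)
Definition prodG : lgraph S :=
  @LGraph S (gV GX * gV GY)%type (gE GX * gE GY)%type
    (fun e => (gsrc e.1, gsrc e.2)) (fun e => (gtgt e.1, gtgt e.2))
    (fun e => glab e.1).

Variables (PY : gE GY -> R) (P : gE prodG -> R).
Hypothesis feasP : MB_feasible PY P.

Lemma feas_ge0 e : 0 <= P e. Proof. by case: feasP. Qed.
Lemma feas_bal (v : gV prodG) : \sum_(e : gE prodG | gsrc e == v) P e =
  \sum_(e : gE prodG | gtgt e == v) P e.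
Proof. by case: feasP. Qed.

Lemma feas_cond (v : gV prodG) ey : 0 < mc_pi P v -> gsrc ey = v.2 ->
  \sum_(e : gE prodG | (e.2 == ey) && (gsrc e == v)) mc_Q P e = mc_Q PY ey.
Proof.
(* Constraint (5) is indexed by pairs of edges, so an edge leaving [v.1] must be found; positive
   mass at [v] provides it. *)
move=> v0 sy; have [e0 /eqP se0] : exists e0 : gE prodG, gsrc e0 == v.
  apply: contrapT => h; move: v0; rewrite /mc_pi big1 ?ltxx// => e se.
  by case: h; exists e.
rewrite -se0 /= in v0 sy *.
have srcE (e : gE prodG) :
    (gsrc e == gsrc e0) = (gsrc e.2 == gsrc ey) && (gsrc e.1 == gsrc e0.1).
  by rewrite -pair_eqE /pair_eq /= sy andbC.
apply: (mulfI (lt0r_neq0 v0)).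
case: feasP => _ _ _ _ /(_ (e0.1, ey)) /= h5.
rewrite [RHS]mulrC mulr_sumr.
transitivity (\sum_(e : gE prodG | (e.2 == ey) && (gsrc e.1 == gsrc e0.1)) P e).
  apply: eq_big => e; last by move=> /andP[_ /eqP h]; rewrite (mul_mc_Q feas_ge0).
  by rewrite srcE; case: eqP => [->|]; rewrite ?eqxx.
by rewrite h5; congr (_ * _); apply: eq_bigl => e; rewrite srcE.
Qed.

(** The [GY] coordinate of the path measure of [P] is the Markov chain [PY]: constraint (3) gives
    the first edge and [feas_cond] every further step. *)
Lemma pathw_marginal n (F : {ffun 'I_n.+1 -> gE GY} -> R) :
  \sum_(q : {ffun 'I_n.+1 -> gE prodG}) pathw P q * F [ffun i => (q i).2] =
  \sum_(p : {ffun 'I_n.+1 -> gE GY}) pathw PY p * F p.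
Proof.
elim: n F => [|n IH] F.
  have pe (G : lgraph S) (e : gE G) : is_path (n := 0) [ffun=> e].
    by apply/forallP => -[].
  rewrite !sum_ffun1 /pathw.
  under eq_bigr => e _ do rewrite pe big_ord0 !ffunE mulr1 mul1r.
  under [RHS]eq_bigr => e _ do rewrite pe big_ord0 !ffunE mulr1 mul1r.
  rewrite (partition_big (fun e : gE prodG => e.2) predT)//=.
  apply: eq_bigr => ey _; case: feasP => _ _ <- _ _; rewrite mulr_suml.
  apply: eq_bigr => e /eqP <-; congr (_ * F _).
  by apply/ffunP => i; rewrite !ffunE.
rewrite [LHS]sum_frcons [RHS]sum_frcons.
(* [F'] averages [F] over the next [GY] edge, which brings the sum back to paths one edge
   shorter. *)
pose F' (p : {ffun 'I_n.+1 -> gE GY}) :=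
  \sum_ey (gtgt (p ord_max) == gsrc ey)%:R * mc_Q PY ey * F (frcons p ey).
transitivity (\sum_(p : {ffun 'I_n.+1 -> gE GY}) pathw PY p * F' p); last first.
  apply: eq_bigr => p _; rewrite mulr_sumr; apply: eq_bigr => ey _.
  by rewrite pathw_frcons mulrA.
rewrite -IH; apply: eq_bigr => q _.
have [q0|q0] := eqVneq (pathw P q) 0.
  rewrite q0 mul0r big1// => e _.
  by rewrite pathw_frcons q0 !mul0r.
have snd_frcons (e : gE prodG) : [ffun i => (frcons q e i).2] =
    frcons [ffun i => (q i).2] e.2.
  apply/ffunP => i; rewrite ffunE; have [lin|nin] := ltnP i n.+1.
    by rewrite !(frconsl _ _ (j := Ordinal lin))// ffunE.
  by rewrite !frconsr//; apply/eqP; rewrite eqn_leq nin -ltnS ltn_ord.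
rewrite (partition_big (fun e : gE prodG => e.2) predT)//= /F' mulr_sumr.
apply: eq_bigr => ey _.
under eq_bigr => e /eqP he do
  rewrite pathw_frcons snd_frcons he -mulrA -[X in _ * X]mulrA.
rewrite -mulr_sumr; congr (_ * _).
under [LHS]eq_bigr do rewrite mulrA; rewrite -mulr_suml ffunE; congr (_ * _).
set v := gtgt (q ord_max); have v0 : 0 < mc_pi P v.
  apply: mc_pi_tgt_gt0; [exact: feas_ge0|exact: feas_bal|].
  by apply: pathw_edge q0.
have [vy|vy] := eqVneq (gtgt (q ord_max).2) (gsrc ey); last first.
  rewrite mul0r big1// => e /eqP he; rewrite (_ : _ == _ = false) ?mul0r//.
  by apply/eqP => -[_] h; move/eqP: vy; apply; rewrite -he.
rewrite mul1r -(feas_cond v0 (esym vy)) big_mkcondr /=; apply: eq_bigr => e _.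
by rewrite eq_sym; case: eqP; rewrite ?mul1r ?mul0r.
Qed.

Lemma pathw_langX n (q : {ffun 'I_n.+1 -> gE prodG}) (a0 : S) : pathw P q != 0 ->
  langB (@csystem S a0 GX) (labels q).
Proof.
move=> /(biinfinite_extension feas_ge0 feas_bal)[z [zp zq]].
exists (fun i => glab (z i).1); split.
  by exists (fun i => (z i).1); split=> // i; have [] := zp i.
by exists 0 => i; rewrite add0r zq ffunE.
Qed.

End coupling.

(** * Distance to a language *)

Section words.
Variables (R : realType) (S : finType) (a0 : S) (mu : probability (seqMeas a0) R).

Definition window n (y : seqMeas a0) : word S n := [ffun i : 'I_n => y (i : nat)%:Z].

Lemma cyl0P n (w : word S n) y : @cyl0 S a0 n w y <-> window n y = w.
Proof.
split=> [h|<- i]; last by rewrite ffunE.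
by apply/ffunP => i; rewrite ffunE; exact: h.
Qed.

Lemma measurable_cyl0 n (w : word S n) : measurable (@cyl0 S a0 n w).
Proof.
rewrite (_ : cyl0 _ = \bigcap_(i in [set: 'I_n]) [set y | y (i : nat)%:Z = w i]).
  apply: fin_bigcap_measurable => // i _.
  by apply: sub_sigma_algebra; exists (i : nat)%:Z, (w i).
by apply/seteqP; split => [y h i _|y h i]; exact: h.
Qed.

Lemma measurable_shift : measurable_fun setT (@Defs.shift S a0).
Proof.
apply: (@measurability _ _ (seqMeas a0) (seqMeas a0) setT _ (@coordG S a0) erefl).
move=> _ [_ [k [a ->]] <-].
by rewrite setTI; apply: sub_sigma_algebra; exists (k + 1), a.
Qed.

Lemma iter_shift n (y : seqMeas a0) k : iter n (@Defs.shift S a0) y k = y (k + n%:Z).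
Proof.
elim: n k => [|n IH] k; first by rewrite addr0.
by rewrite iterS /Defs.shift IH -addrA -PoszD add1n.
Qed.

(** The cylinders of length [n] partition the space, so a function of the window is simple; its
    measurability and its mean follow from this form. *)
Lemma windowE n (H : word S n -> R) y :
  H (window n y) = \sum_w H w * \1_(@cyl0 S a0 n w) y.
Proof.
rewrite (bigD1 (window n y))//= indicE mem_set ?mulr1; last exact/cyl0P.
rewrite big1 ?addr0// => w wy; rewrite indicE memNset ?mulr0//.
by move=> /cyl0P h; rewrite h eqxx in wy.
Qed.

Lemma bmeas_window n (H : word S n -> R) : bmeas (fun y => H (window n y)).
Proof.
under eq_fun do rewrite windowE.
by apply: bmeas_sum => w; apply: bmeasZ; apply: bmeas_indic; exact: measurable_cyl0.
Qed.

Lemma mean_window n (H : word S n -> R) :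
  mean mu (fun y => H (window n y)) = \sum_w H w * fine (mu (@cyl0 S a0 n w)).
Proof.
rewrite (_ : (fun y => _) = fun y => \sum_w H w * \1_(@cyl0 S a0 n w) y); last first.
  by apply/funext => y; exact: windowE.
have mC (w : word S n) := @bmeas_indic _ _ R _ (measurable_cyl0 w).
rewrite mean_sum; last by move=> w; exact: bmeasZ.
apply: eq_bigr => w _; rewrite meanZ// mean_indic//; exact: measurable_cyl0.
Qed.

End words.

Lemma hammingE (S : finType) n (x w : word S n) :
  hamming x w = (\sum_(i < n) (x i != w i))%N.
Proof.
rewrite /hamming -sum1_card big_mkcond; apply: eq_bigr => i _.
by case: (boolP (x i != w i)) => h; [rewrite mem_set|rewrite memNset//=; exact/negP].
Qed.

(** For each offset [j] the indices [i + j] form a subinterval of [0, N + m), so each of the [m]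
    offsets contributes at most the full sum. *)
Lemma sum_windows_le (e : nat -> nat) N m :
  (\sum_(i < N) \sum_(j < m) e (i + j) <= m * \sum_(l < N + m) e l)%N.
Proof.
rewrite exchange_big /= -[X in (_ <= X * _)%N]card_ord -sum_nat_const.
apply: leq_sum => j _.
rewrite -(big_mkord predT (fun i => e (i + j)%N)) -(big_mkord predT e).
rewrite [X in (_ <= X)%N](big_cat_nat (n := j))//=; last first.
  by rewrite (leq_trans (ltnW (ltn_ord j)))// leq_addl.
rewrite [X in (_ <= _ + X)%N](big_cat_nat (n := (N + j)%N))/=; last 2 first.
- by rewrite leq_addl.
- by rewrite leq_add2l ltnW.
have -> : (\sum_(j <= l < N + j) e l = \sum_(0 <= i < N) e (i + j))%N.
  by rewrite -{1}[nat_of_ord j]add0n big_addn addnK.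
by rewrite addnCA leq_addr.
Qed.

Section distance_to_language.
Variables (S : finType) (a0 : S) (X : set (seqMeas a0)) (x0 : seqMeas a0).
Hypothesis Xx0 : X x0.

(** The Hamming distance from [w] to the language of X; [window n x0] is the member of the language
    that [arg min] starts from. *)
Definition dlang n (w : word S n) : nat :=
  hamming [arg min_(x < window n x0 | `[< langB X x >]) hamming x w] w.

Lemma langB_window n : langB X (window n x0).
Proof. by exists x0; split=> //; exists 0 => i; rewrite ffunE add0r. Qed.

Lemma dlang_min n (w : word S n) :
  (exists x, langB X x /\ hamming x w = dlang w) /\
  (forall x, langB X x -> (dlang w <= hamming x w)%N).
Proof.
rewrite /dlang; case: arg_minnP => [|x /asboolP Xx xmin].
  by apply/asboolP; exact: langB_window.
by split=> [|z Xz]; [exists x | apply: xmin; exact/asboolP].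
Qed.

(** Subwords of a nearest word of length [N + m] again lie in the language, so they bound the
    distances of the short windows; each mismatch falls into at most [m] windows. *)
Lemma dlang_windows N m (y : seqMeas a0) :
  (\sum_(i < N) dlang (window m (iter i (@Defs.shift S a0) y))
   <= m * dlang (window (N + m) y))%N.
Proof.
have [[x [[z [Xz [k xz]]] <-]] _] := dlang_min (window (N + m) y).
pose e (l : nat) : nat := z (k + l%:Z) != y l%:Z.
rewrite hammingE; under [X in (_ <= _ * X)%N]eq_bigr => l _ do rewrite xz ffunE -/(e l).
apply: leq_trans (sum_windows_le e N m); apply: leq_sum => i _.
pose x' : word S m := [ffun j : 'I_m => z (k + i%:Z + (j : nat)%:Z)].
have Xx' : langB X x'.
  by exists z; split=> //; exists (k + i%:Z) => j; rewrite ffunE.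
apply: leq_trans ((dlang_min _).2 _ Xx') _.
rewrite hammingE; apply: leq_sum => j _.
by rewrite !ffunE iter_shift /e PoszD addrA [_%:Z + i%:Z]addrC.
Qed.

End distance_to_language.

(** * Concentration of the normalised distance *)

Section concentration.
Variables (R : realType) (S : finType) (a0 : S) (mu : probability (seqMeas a0) R).
Hypothesis invmu : forall A : set (seqMeas a0), measurable A ->
  mu (@Defs.shift S a0 @^-1` A) = mu A.
Hypothesis ergmu : ergodic mu.
Variables (X : set (seqMeas a0)) (x0 : seqMeas a0).
Hypothesis Xx0 : X x0.
Variable D : R.
Local Notation F n := (fun y : seqMeas a0 => (dlang X x0 (window n y))%:R : R).
Hypothesis meanF : forall n, mean mu (F n.+1) <= n.+1%:R * D.

Let bF n : bmeas (F n).
Proof. exact: (bmeas_window a0 (fun w : word S n => (dlang X x0 w)%:R)). Qed.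

(** The distance is at least about [n * c] outside a small set while its mean is at most [n * c]; an
    excess of order [n * delta] with probability above [eps] would push the mean too high. *)
Lemma dlang_concentration (delta eps : R) : 0 < delta -> 0 < eps ->
  exists n0 : nat, forall n, (n0 <= n)%N ->
    mean mu (fun y => (n%:R * (D + delta) < (dlang X x0 (window n y))%:R :> R)%:R : R) <= eps.
Proof.
move=> d0 e0.
pose A := [set mean mu (F m.+1) / m.+1%:R | m in [set: nat]].
have supA : has_sup A.
  split; first by exists (mean mu (F 1) / 1), 0%N.
  exists D => _ [m _ <-]; rewrite ler_pdivrMr ?ltr0n// mulrC; exact: meanF.
pose c := sup A.
have cD : c <= D.
  apply: sup_le_ub; first by case: supA.
  move=> _ [m _ <-]; rewrite ler_pdivrMr ?ltr0n// mulrC; exact: meanF.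
have Fc n : mean mu (F n.+1) <= n.+1%:R * c.
  rewrite mulrC -ler_pdivrMr ?ltr0n//; apply: sup_upper_bound => //.
  by exists n.
have c0 : 0 <= c.
  have := Fc 0%N; rewrite mul1r; apply: le_trans.
  rewrite -(mean_cst mu 0); apply: mean_le => //; exact: bmeas_cst.
(* Four errors of size [eta] are spent: three in [low], one on the exceptional set [B]. *)
pose eta := delta * eps / 4.
have eta0 : 0 < eta by rewrite /eta !mulr_gt0.
have [_ [m _ <-] mc] := sup_adherent eta0 supA; rewrite -/c in mc.
rewrite ltr_pdivlMr ?ltr0n// in mc.
set am := mean mu (F m.+1) in mc.
(* This bound on [mu B] makes [c * mu B] at most [eta]; the [+ 1] covers [c = 0]. *)
have c1 : 0 < eta / (c + 1) by rewrite divr_gt0// ltr_wpDl.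
have [K [B [mB muB hB]]] :=
  bsum_lower_bound (@measurable_shift S a0) invmu ergmu (bF m.+1) eta0 c1.
(* From here on [n * eta] absorbs the loss from the last [m.+1] positions and the constant [K]. *)
pose n1 := (m.+1 + Num.bound ((m.+1%:R * c + K%:R) / eta))%N.
exists n1 => n n1n.
have [N nE] : exists N, n = (N + m.+1)%N.
  by exists (n - m.+1)%N; rewrite subnK// (leq_trans _ n1n)// leq_addr.
have nbig : m.+1%:R * c + K%:R <= n%:R * eta.
  rewrite -ler_pdivrMr//; apply: (@le_trans _ _ (Num.bound ((m.+1%:R * c + K%:R) / eta))%:R).
    apply/ltW/archi_boundP; rewrite divr_ge0 ?(ltW eta0)// addr_ge0// mulr_ge0//.
  by rewrite ler_nat (leq_trans _ n1n)// leq_addl.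
pose U (y : seqMeas a0) : bool := n%:R * (D + delta) < (dlang X x0 (window n y))%:R :> R.
have bU : bmeas (fun y => (U y)%:R : R).
  exact: (bmeas_window a0 (fun w : word S n => (n%:R * (D + delta) < (dlang X x0 w)%:R :> R)%:R)).
(* On [U] the distance exceeds [n * (D + delta)] and [c <= D]; on [B] the term with [\1_B] pays;
   elsewhere the ergodic bound applies, with one [eta] each for the choice of [m], the ergodic error
   and the boundary. *)
have low (y : seqMeas a0) : n%:R * (c - 3 * eta) + (n%:R * delta) * (U y)%:R
    <=  (dlang X x0 (window n y))%:R + (n%:R * c) * \1_B y.
  have n0 : 0 <= n%:R :> R by [].
  have ne : 0 <= n%:R * eta by rewrite mulr_ge0// ltW.
  have nc : 0 <= n%:R * c by rewrite mulr_ge0.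
  rewrite indicE; case: (boolP (U y)) => [Uy|_].
    have : n%:R * c <= n%:R * D by rewrite ler_wpM2l.
    move: Uy; rewrite /U.
    by case: (y \in B) => /=; lra.
  have [yB|yB] := boolP (y \in B).
    have : 0 <= (dlang X x0 (window n y))%:R :> R by [].
    by rewrite /=; lra.
  have /(hB y N) : ~ B y by move=> h; rewrite mem_set in yB.
  rewrite -/am => h.
  have h2 : bsum (@Defs.shift S a0) (F m.+1) N y <= m.+1%:R * (dlang X x0 (window n y))%:R.
    rewrite /bsum -natr_sum -natrM ler_nat nE; exact: dlang_windows.
  have h3 : N%:R * (m.+1%:R * c - m.+1%:R * eta - eta) - K%:R <=
      m.+1%:R * (dlang X x0 (window n y))%:R.
    apply: le_trans h2; apply: le_trans h; rewrite lerD2r ler_wpM2l//; lra.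
  have N0 : 0 <= N%:R :> R by [].
  have M1 : 1 <= m.+1%:R :> R by rewrite ler1n.
  have nM : n%:R = N%:R + m.+1%:R :> R by rewrite nE natrD.
  rewrite !mulr0 !addr0 -(ler_pM2l (x := m.+1%:R)) ?ltr0n//.
  apply: le_trans h3.
  set M : R := m.+1%:R in M1 nM nbig *.
  move: nbig ne; rewrite nM; set p : R := N%:R in N0 *; set k : R := K%:R => nbig ne.
  have k0 : 0 <= k by [].
  have h4 : M * (M * c + k) <= M * ((p + M) * eta) by rewrite ler_wpM2l//; lra.
  have h5 : 0 <= (M - 1) * k by rewrite mulr_ge0//; lra.
  have h6 : 0 <= (M - 1) * (p * eta) by rewrite mulr_ge0 ?mulr_ge0//; lra.
  have h7 : 0 <= M * (M * eta) by rewrite !mulr_ge0//; lra.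
  lra.
have n0 : 0 < n%:R :> R by rewrite nE addnS ltr0n.
have nd : 0 < n%:R * delta by rewrite mulr_gt0.
have bI : bmeas (fun y : seqMeas a0 => (n%:R * c) * \1_B y) by apply: bmeasZ; exact: bmeas_indic.
have bdU : bmeas (fun y : seqMeas a0 => (n%:R * delta) * (U y)%:R) by exact: bmeasZ.
have := mean_le mu (bmeasD (bmeas_cst _ (n%:R * (c - 3 * eta))) bdU) (bmeasD (bF n) bI) low.
rewrite !meanD//; last exact: bmeas_cst.
rewrite mean_cst !meanZ//; last exact: bmeas_indic.
rewrite mean_indic//.
have muB' : c * fine (mu B) <= eta.
  have : fine (mu B) < eta / (c + 1).
    by rewrite -lte_fin fineK// fin_num_measure.
  rewrite ltr_pdivlMr ?ltr_wpDl// => h.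
  have : 0 <= fine (mu B) by rewrite fine_ge0.
  lra.
have Fn : mean mu (F n) <= n%:R * c by rewrite nE addnS; exact: Fc.
set u := mean mu (fun y => (U y)%:R : R) => h.
have {}h : n%:R * (delta * u) <= n%:R * (4 * eta).
  have : n%:R * (c * fine (mu B)) <= n%:R * eta by rewrite ler_wpM2l// ltW.
  lra.
rewrite ler_pM2l// in h.
have : delta * u <= delta * eps by rewrite /eta in h; lra.
by rewrite ler_pM2l.
Qed.

End concentration.

(** * Comparison of lower limits *)

Section limn_einf.
Context {R : realType}.
Implicit Types u v : nat -> \bar R.
Local Open Scope ereal_scope.

Lemma limn_einf_le_near u l n0 : (forall n, (n0 <= n)%N -> u n <= l) ->
  limn_einf u <= l.
Proof.
move=> ul; rewrite limn_einf_lim; apply: lime_le; first exact: is_cvg_einfs.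
apply: nearW => n; apply: (@le_trans _ _ (u (maxn n n0))).
  by apply: ereal_inf_lbound; exists (maxn n n0) => //=; exact: leq_maxl.
by apply: ul; exact: leq_maxr.
Qed.

Lemma le_limn_einf u v : (forall n, u n <= v n) -> limn_einf u <= limn_einf v.
Proof.
move=> uv; rewrite !limn_einf_lim; apply: lee_lim; [exact: is_cvg_einfs..|].
apply: nearW => n; apply: le_ereal_inf_tmp => _ [k /= nk <-].
by apply: le_trans (uv k); apply: ereal_inf_lbound; exists k.
Qed.

End limn_einf.

(** * From a feasible point to a bound on [Reps] *)

Section coding_bound.
Variables (R : realType) (S : finType) (a0 : S) (GX GY : lgraph S).
Variables (PY : gE GY -> R) (hPY : stationary_mc PY).
Variables (mu : probability (seqMeas a0) R) (hmu : is_hmm_measure PY mu).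
Hypothesis herg : ergodic mu.
Variables (P : gE (prodG GX GY) -> R) (feasP : MB_feasible PY P).
Local Notation X := (@csystem S a0 GX).
Local Notation Y := (@csystem S a0 GY).

Lemma fine_cyl0 n (w : word S n.+1) : fine (mu (@cyl0 S a0 _ w)) = hmm_prob PY w.
Proof. by rewrite hmu.2. Qed.

(** Shows that the restriction to words of Y in [Reps_n] discards no mass: a word of positive
    probability labels a path of positive weight, which extends bi-infinitely. *)
Lemma cyl0_langB n (w : word S n.+1) :
  fine (mu (@cyl0 S a0 _ w)) != 0 -> langB Y w.
Proof.
case: hPY => PY0 _ PYb _; rewrite fine_cyl0 hmm_probE => w0.
have [p /eqP <- p0] : exists2 p, labels p == w & pathw PY p != 0.
  apply: contrapT => h; move/eqP: w0; apply; apply: big1 => p pw.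
  by apply/eqP; apply: contrapT => /negP p0; apply: h; exists p.
have [z [zp zq]] := biinfinite_extension PY0 PYb p0.
exists (fun i => glab (z i)); split; first by exists z.
by exists 0 => i; rewrite add0r zq ffunE.
Qed.

(** Total mass 1 gives a product edge of positive weight, and the bi-infinite path through it
    projects to [GX]. *)
Lemma csystem_nonempty : exists x0, X x0.
Proof.
have [q q0] : exists q : {ffun 'I_1 -> gE (prodG GX GY)}, pathw P q != 0.
  apply: contrapT => h.
  have := sum_pathw (feas_ge0 feasP) (feas_bal feasP) 0.
  case: feasP => _ -> _ _ _; rewrite big1 => [/esym/eqP|q _]; first by rewrite oner_eq0.
  by apply/eqP; apply: contrapT => /negP q0; apply: h; exists q.
by have [x [Xx _]] := pathw_langX feasP a0 q0; exists x.
Qed.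

Variable x0 : seqMeas a0.
Hypothesis Xx0 : X x0.

(** [pathw_marginal] lifts the mean to product paths. There the [GX] labels form a word of the
    language, so the distance is at most the number of label mismatches, whose mean [pathw_cost]
    computes. *)
Lemma mean_dlang n :
  mean mu (fun y => (dlang X x0 (window n.+1 y))%:R : R) <= n.+1%:R * MB_objective P.
Proof.
rewrite (mean_window mu (fun w : word S n.+1 => (dlang X x0 w)%:R : R)).
have -> : \sum_w (dlang X x0 w)%:R * fine (mu (@cyl0 S a0 n.+1 w)) =
    \sum_(p : {ffun 'I_n.+1 -> gE GY}) pathw PY p * (dlang X x0 (labels p))%:R.
  rewrite [RHS](partition_big (@labels S GY n.+1) predT)//=.
  apply: eq_bigr => w _; rewrite fine_cyl0 hmm_probE mulr_sumr.
  by apply: eq_bigr => p /eqP ->; rewrite mulrC.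
rewrite -(pathw_marginal feasP (fun p => (dlang X x0 (labels p))%:R)).
have -> : MB_objective P = \sum_e P e * (glab e.1 != glab e.2)%:R.
  rewrite /MB_objective big_mkcond; apply: eq_bigr => e _.
  by case: (_ != _); rewrite ?mulr1 ?mulr0.
rewrite -(pathw_cost (feas_ge0 feasP) (feas_bal feasP)).
apply: ler_sum => q _; have [->|q0] := eqVneq (pathw P q) 0; first by rewrite !mul0r.
rewrite ler_wpM2l ?(pathw_ge0 (feas_ge0 feasP))// -natr_sum ler_nat.
apply: leq_trans ((dlang_min Xx0 _).2 _ (pathw_langX feasP a0 q0)) _.
by rewrite hammingE; apply: leq_sum => i _; rewrite !ffunE.
Qed.

Lemma Reps_n_le (eps r : R) n : 0 <= r ->
  mean mu (fun y => (r < (dlang X x0 (window n.+1 y))%:R :> R)%:R : R) <= eps ->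
  (Reps_n X Y mu eps n.+1 <= r%:E)%E.
Proof.
(* Distances are integers, so the balls of integer radius [Num.truncn r] already contain every word
   at distance at most [r]. *)
move=> r0 far; apply: (@le_trans _ _ (Num.truncn r)%:R%:E); last first.
  by rewrite lee_fin truncn_le.
apply: ereal_inf_lbound; exists (Num.truncn r) => //=.
have -> : 1 - eps <= mu_n mu (fun w : word S n.+1 =>
    langB Y w /\ exists x, langB X x /\ (hamming x w <= Num.truncn r)%N) = true; last by [].
pose H (w : word S n.+1) : R := (r < (dlang X x0 w)%:R :> R)%:R.
rewrite (mean_window mu H) in far.
have tot : \sum_w fine (mu (@cyl0 S a0 n.+1 w)) = 1.
  rewrite -(mean_cst mu 1) (mean_window mu (fun _ : word S n.+1 => 1)).
  by apply: eq_bigr => w _; rewrite mul1r.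
rewrite lerBlDr -tot /mu_n [X in _ <= X + _]big_mkcond -lerBlDl.
apply: le_trans far; rewrite -sumrB; apply: ler_sum => w _.
have mu0 : 0 <= fine (mu (@cyl0 S a0 n.+1 w)) by rewrite fine_ge0.
have [w0|w0] := eqVneq (fine (mu (@cyl0 S a0 n.+1 w))) 0.
  by rewrite w0 mulr0; case: asboolP; rewrite subrr.
rewrite /H; case: asboolP => [_|far]; first by rewrite subrr mulr_ge0.
rewrite subr0; case: ltP => [_|near]; first by rewrite mul1r.
case: far; split; first exact: cyl0_langB.
have [[x [Xx xw]] _] := dlang_min Xx0 w; exists x; split=> //.
by rewrite xw truncn_ge_nat.
Qed.

Lemma Reps_le_objective eps : 0 < eps -> (Reps X Y mu eps <= (MB_objective P)%:E)%E.
Proof.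
move=> e0; apply/lee_addgt0Pr => delta d0.
have D0 : 0 <= MB_objective P by apply: sumr_ge0 => e _; exact: feas_ge0 feasP e.
have [n0 hn0] := dlang_concentration hmu.1 herg Xx0 mean_dlang d0 e0.
(* Starting at [n0.+1] excludes length 0, where [n^-1] would not cancel [n]. *)
apply: (@limn_einf_le_near _ _ _ n0.+1) => -[//|n] n0n.
apply: (@le_trans _ _ (n.+1%:R^-1%:E * (n.+1%:R * (MB_objective P + delta))%:E)%E).
  rewrite lee_wpmul2l ?lee_fin ?invr_ge0//; apply: Reps_n_le; last exact/hn0/ltnW.
  by rewrite mulr_ge0// addr_ge0// ltW.
by rewrite -EFinM mulKf ?pnatr_eq0// EFinD.
Qed.

End coding_bound.

(** A larger [eps] admits more radii. This monotonicity is what makes the limit in [R0] exist. *)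
Lemma Reps_noninc (R : realType) (S : finType) (a0 : S) (X Y : set (seqMeas a0))
  (mu : probability (seqMeas a0) R) : {homo Reps X Y mu : e e' / e <= e' >-> (e' <= e)%E}.
Proof.
move=> e e' ee'; apply: le_limn_einf => n; rewrite lee_wpmul2l ?lee_fin ?invr_ge0//.
apply: ereal_inf_le_tmp => _ [r hr <-]; exists r => //=.
by apply: le_trans hr; rewrite lerD2l lerN2.
Qed.

Theorem theorem28 (R : realType) (S : finType) (a0 : S)
  (GX GY : lgraph S)
  (hX : no_parallel_same_label GX) (hY : no_parallel_same_label GY)
  (PY : gE GY -> R) (hPY : stationary_mc PY)
  (mu : probability (seqMeas a0) R)
  (hmu : is_hmm_measure PY mu) (herg : ergodic mu) :
  (R0 (@csystem S a0 GX) (@csystem S a0 GY) mu <= MB GX PY)%E.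
Proof.
apply: le_ereal_inf_tmp => _ [P feasP <-].
have [x0 Xx0] := csystem_nonempty a0 feasP.
pose Re := Reps (@csystem S a0 GX) (@csystem S a0 GY) mu.
have ni : {in Interval (BRight (0 : R)) (BInfty _ false) &,
    {homo Re : e e' / e <= e' >-> (e' <= e)%E}}.
  by move=> e e' _ _; exact: Reps_noninc.
(* By monotonicity the right limit at 0 is the supremum over [eps > 0], so a bound uniform in [eps]
   passes to it. *)
have cv := @nonincreasing_at_right_cvge R Re 0 (BInfty _ false) isT ni.
rewrite /R0 -/Re (cvg_lim _ cv)//.
apply: ub_ereal_sup => _ [e /= e0 <-].
rewrite in_itv /= andbT in e0.
exact: (Reps_le_objective hPY hmu herg feasP Xx0 e0).
Qed.
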